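(* Let $A\in\mathcal{V}$ be an algebra such that $K(A)$ is closed under the commutator operation, and assume that $A$ fulfills the condition $(\star)$. If $I$ is an ideal of the lattice $L(A)$ then $(Ann(I))_{\ast}=I_{\ast}\rightarrow\rho(\Delta_A)$; if $A$ is semiprime then $(Ann(I))_{\ast}=(I_{\ast})^{\perp}$.
   Context: $\mathcal{V}$ is a fixed congruence-modular variety of algebras (of a finite signature) that is semidegenerate: no nontrivial algebra in $\mathcal{V}$ has one-element subalgebras (equivalently, $\nabla_A$ is compact in $Con(A)$ for every $A\in\mathcal{V}$). For $A\in\mathcal{V}$, $Con(A)$ is the complete lattice of congruences of $A$, with least element $\Delta_A$ and greatest element $\nabla_A$; $K(A)$ is the set of compact (= finitely generated) congruences. Commutator: $[\cdot,\cdot]=[\cdot,\cdot]_A$ is the (modular) commutator, i.e. the greatest operation on the congruence lattices of members of $\mathcal{V}$ such that for every surjective morphism $f:A\to B$ in $\mathcal{V}$ and all $\alpha,\beta\in Con(A)$: $[\alpha,\beta]_A\subseteq\alpha\cap\beta$ and $[\alpha,\beta]_A\vee Ker(f)=f^{-1}([f(\alpha\vee Ker(f)),f(\beta\vee Ker(f))]_B)$. Residuation: $\alpha\rightarrow\beta=\bigvee\{\gamma\in Con(A)\mid[\alpha,\gamma]\subseteq\beta\}$ and $\alpha^{\perp}=\alpha\rightarrow\Delta_A$. Iterates: $[\alpha,\alpha]^0=\alpha$, $[\alpha,\beta]^1=[\alpha,\beta]$, $[\alpha,\beta]^{n+1}=[[\alpha,\beta]^n,[\alpha,\beta]^n]$.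 Condition $(\star)$: for all $\alpha,\beta\in K(A)$ and every integer $n\geq 1$ there is an integer $m\geq 0$ with $[[\alpha,\alpha]^m,[\beta,\beta]^m]\subseteq[\alpha,\beta]^n$. $\phi\in Con(A)\setminus\{\nabla_A\}$ is prime if $[\alpha,\beta]\subseteq\phi$ implies $\alpha\subseteq\phi$ or $\beta\subseteq\phi$ (for $\alpha,\beta\in Con(A)$); $Spec(A)$ is the set of prime congruences; $\rho(\theta)=\bigcap\{\phi\in Spec(A)\mid\theta\subseteq\phi\}$; $A$ is semiprime if $\rho(\Delta_A)=\Delta_A$. Reticulation: when $K(A)$ is closed under the commutator, $L(A)=K(A)/{\equiv}$ where $\alpha\equiv\beta$ iff $\rho(\alpha)=\rho(\beta)$; $\lambda_A:K(A)\to L(A)$ is the quotient map; $L(A)$ is a bounded distributive lattice with $\lambda_A(\alpha)\vee\lambda_A(\beta)=\lambda_A(\alpha\vee\beta)$, $\lambda_A(\alpha)\wedge\lambda_A(\beta)=\lambda_A([\alpha,\beta])$, $0=\lambda_A(\Delta_A)$, $1=\lambda_A(\nabla_A)$. For an ideal $I$ of $L(A)$, $I_{\ast}=\bigvee\{\alpha\in K(A)\mid\lambda_A(\alpha)\in I\}\in Con(A)$. For an ideal $I$ of a bounded distributive lattice $L$, $Ann(I)=\{x\in L\mid x\wedge y=0\text{ for all }y\in I\}$. *)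

(* Defs.v *)
From HB Require Import structures.
From mathcomp Require Import all_boot all_order.
From mathcomp Require Import boolp classical_sets.

Set Implicit Arguments.
Unset Strict Implicit.
Unset Printing Implicit Defensive.
Import Order.TTheory.
Local Open Scope quotient_scope.
Local Open Scope classical_set_scope.
Local Open Scope order_scope.
#[local] Obligation Tactic := idtac.

Record signature := Signature { symbol : finType; arity : symbol -> nat }.

Record algebra (S : signature) := Algebra {
  carrier :> Type;
  carrier_inh : inhabited carrier;
  op : forall o : symbol S, ('I_(arity o) -> carrier) -> carrier }.
Arguments op {S} a o.

Inductive term (S : signature) : Type :=
| Var of nat
| App (o : symbol S) of ('I_(arity o) -> term S).
Arguments Var {S}.

Fixpoint eval (S : signature) (A : algebra S) (v : nat -> A) (t : term S) : A :=
  match t with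
  | Var n => v n
  | App o ts => op A o (fun i => eval v (ts i))
  end.

(* A variety is given by its defining identities. *)
Definition variety (S : signature) := set (term S * term S).

Definition in_variety (S : signature) (V : variety S) (A : algebra S) : Prop :=
  forall e, V e -> forall v : nat -> A, eval v e.1 = eval v e.2.

Definition subuniverse (S : signature) (A : algebra S) (U : set A) : Prop :=
  forall o (x : 'I_(arity o) -> A), (forall i, U (x i)) -> U (op A o x).

Definition semidegenerate (S : signature) (V : variety S) : Prop :=
  forall A : algebra S, in_variety V A ->
    (exists a : A, subuniverse [set a]) -> forall x y : A, x = y.

Record surj_hom (S : signature) (A B : algebra S) := SurjHom {
  hom_fun :> A -> B;
  hom_op : forall o (x : 'I_(arity o) -> A),
    hom_fun (op A o x) = op B o (fun i => hom_fun (x i));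
  hom_surj : forall y, exists x, hom_fun x = y }.

Record con (S : signature) (A : algebra S) := Con {
  con_rel :> A -> A -> Prop;
  con_refl : forall x, con_rel x x;
  con_sym : forall x y, con_rel x y -> con_rel y x;
  con_trans : forall y x z, con_rel x y -> con_rel y z -> con_rel x z;
  con_op : forall o (x y : 'I_(arity o) -> A),
    (forall i, con_rel (x i) (y i)) -> con_rel (op A o x) (op A o y) }.

HB.instance Definition _ (S : signature) (A : algebra S) := gen_eqMixin (con A).
HB.instance Definition _ (S : signature) (A : algebra S) :=
  gen_choiceMixin (con A).

Lemma con_ext (S : signature) (A : algebra S) (α β : con A) :
  (forall x y, α x y <-> β x y) -> α = β.
Proof.
case: α β => [a a1 a2 a3 a4] [b b1 b2 b3 b4] /= h.
have ab : a = b by apply/funext => x; apply/funext => y; apply/propext.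
by case: _ / ab in b1 b2 b3 b4 h *; congr Con; exact: Prop_irrelevance.
Qed.

Section ConLattice.
Context {S : signature} {A : algebra S}.
Implicit Types α β γ : con A.

Definition con_le α β : bool := `[< forall x y, α x y -> β x y >].

Fact con_le_refl : reflexive con_le. Proof. by move=> α; apply/asboolP. Qed.
Fact con_le_anti : antisymmetric con_le.
Proof.
move=> α β /andP[/asboolP h1 /asboolP h2]; apply: con_ext => x y.
by split; [exact: h1|exact: h2].
Qed.
Fact con_le_trans : transitive con_le.
Proof.
by move=> β α γ /asboolP h1 /asboolP h2; apply/asboolP => x y /h1 /h2.
Qed.

Fact con_display : Order.disp_t. Proof. exact: Order.Disp tt tt. Qed.
HB.instance Definition _ := Order.Le_isPOrder.Build con_display (con A)
  con_le_refl con_le_anti con_le_trans.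

Lemma con_leP α β : reflect (forall x y, α x y -> β x y) (α <= β).
Proof. exact: asboolP. Qed.

Program Definition con_inf (F : set (con A)) : con A :=
  @Con S A (fun x y => forall θ, F θ -> θ x y) _ _ _ _.
Next Obligation. by move=> F x θ _; exact: con_refl. Qed.
Next Obligation. by move=> F x y h θ /h; exact: con_sym. Qed.
Next Obligation.
by move=> F y x z h1 h2 θ Fθ; apply: con_trans (h1 _ Fθ) (h2 _ Fθ).
Qed.
Next Obligation. by move=> F o x y h θ Fθ; apply: con_op => i; exact: h. Qed.

Definition con_sup (F : set (con A)) : con A :=
  con_inf [set θ | forall σ, F σ -> σ <= θ].

Lemma con_inf_lb (F : set (con A)) α : F α -> con_inf F <= α.
Proof. by move=> Fα; apply/con_leP => x y; apply. Qed.

Lemma con_inf_glb (F : set (con A)) β :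
  (forall α, F α -> β <= α) -> β <= con_inf F.
Proof. by move=> h; apply/con_leP => x y bxy θ /h/con_leP; apply. Qed.

Lemma con_sup_ub (F : set (con A)) α : F α -> α <= con_sup F.
Proof. by move=> Fα; apply: con_inf_glb => θ; apply. Qed.

Lemma con_sup_lub (F : set (con A)) β :
  (forall α, F α -> α <= β) -> con_sup F <= β.
Proof. exact: con_inf_lb. Qed.

Definition con_meet α β := con_inf [set α; β].
Definition con_join α β := con_sup [set α; β].

Fact con_meetP α β γ : (α <= con_meet β γ) = (α <= β) && (α <= γ).
Proof.
apply/idP/andP => [h|[h1 h2]]; last by apply: con_inf_glb => θ [->|->].
by split; apply: le_trans h _; apply: con_inf_lb; [left|right].
Qed.
Fact con_joinP α β γ : (con_join α β <= γ) = (α <= γ) && (β <= γ).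
Proof.
apply/idP/andP => [h|[h1 h2]]; last by apply: con_sup_lub => θ [->|->].
by split; apply: le_trans h; apply: con_sup_ub; [left|right].
Qed.
HB.instance Definition _ := Order.POrder_MeetJoin_isLattice.Build con_display
  (con A) con_meetP con_joinP.

Program Definition con_delta : con A := @Con S A (fun x y => x = y) _ _ _ _.
Next Obligation. by []. Qed.
Next Obligation. by move=> x y ->. Qed.
Next Obligation. by move=> y x z -> ->. Qed.
Next Obligation. by move=> o x y h; congr op; apply/funext. Qed.

Definition con_nabla : con A := @Con S A (fun _ _ => True)
  (fun=> I) (fun _ _ _ => I) (fun _ _ _ _ _ => I) (fun _ _ _ _ => I).

Fact con_delta_le α : con_delta <= α.
Proof. by apply/con_leP => x _ <-; exact: con_refl. Qed.
HB.instance Definition _ :=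
  Order.hasBottom.Build con_display (con A) con_delta_le.
Fact con_nabla_ge α : α <= con_nabla. Proof. exact/con_leP. Qed.
HB.instance Definition _ :=
  Order.hasTop.Build con_display (con A) con_nabla_ge.

Definition compact α : Prop := forall F : set (con A), α <= con_sup F ->
  exists s : seq (con A),
    (forall θ, θ \in s -> F θ) /\ α <= \join_(θ <- s) θ.

Lemma compactU α β : compact α -> compact β -> compact (α `|` β).
Proof.
move=> cα cβ F; rewrite leUx => /andP[/cα[s [sF hs]] /cβ[t [tF ht]]].
exists (s ++ t); split.
  by move=> θ; rewrite mem_cat => /orP[/sF|/tF].
by rewrite big_cat /= leU2.
Qed.

Lemma compact0 : compact \bot.
Proof. by move=> F _; exists [::]; split => //; exact: le0x. Qed.

End ConLattice.

(* [con_push f α] is [f(α ∨ Ker f)], a congruence because [f] is onto. *)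
Section Morphisms.
Context {S : signature} {A B : algebra S} (f : surj_hom A B).

Program Definition con_pull (θ : con B) : con A :=
  @Con S A (fun x y => θ (f x) (f y)) _ _ _ _.
Next Obligation. by move=> θ x; exact: con_refl. Qed.
Next Obligation. by move=> θ x y; exact: con_sym. Qed.
Next Obligation. by move=> θ y x z; exact: con_trans. Qed.
Next Obligation. by move=> θ o x y h; rewrite /= !hom_op; exact: con_op. Qed.

Definition con_ker : con A := con_pull \bot.

Program Definition con_push (α : con A) : con B :=
  @Con S B (fun u v => exists x y, [/\ f x = u, f y = v & (α `|` con_ker) x y])
    _ _ _ _.
Next Obligation.
by move=> α u; have [x <-] := hom_surj f u; exists x, x; split=> //; exact: con_refl.
Qed.
Next Obligation.
by move=> α u v [x [y [? ? h]]]; exists y, x; split=> //; exact: con_sym.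
Qed.
Next Obligation.
move=> α v u w [x [y [<- <- h]]] [x' [y' [e <- h']]]; exists x, y'; split=> //.
apply: con_trans h _; apply: con_trans h'.
by have /con_leP := leUr con_ker α; apply; exact: esym.
Qed.
Next Obligation.
move=> α o u v h.
have [xy hxy] := choice (fun i => match h i with
  ex_intro x (ex_intro y p) => ex_intro (fun xy : A * A =>
    [/\ f xy.1 = u i, f xy.2 = v i & (α `|` con_ker) xy.1 xy.2]) (x, y) p end).
exists (op A o (fun i => (xy i).1)), (op A o (fun i => (xy i).2)).
rewrite !hom_op; split; first by congr op; apply/funext => i; case: (hxy i).
  by congr op; apply/funext => i; case: (hxy i).
by apply: con_op => i; case: (hxy i).
Qed.

End Morphisms.

Definition congruence_modular (S : signature) (V : variety S) : Prop :=
  forall A : algebra S, in_variety V A -> forall α β γ : con A,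
    α <= γ -> α `|` (β `&` γ) = (α `|` β) `&` γ.

Definition con_operation (S : signature) :=
  forall A : algebra S, con A -> con A -> con A.

Definition commutator_like (S : signature) (V : variety S)
    (C : con_operation S) : Prop :=
  forall A B : algebra S, in_variety V A -> in_variety V B ->
  forall (f : surj_hom A B) (α β : con A),
    C A α β <= α `&` β /\
    C A α β `|` con_ker f = con_pull f (C B (con_push f α) (con_push f β)).

(* The join of all operations as above; it is again one of them, hence the
   greatest one: see [comm_like] and [comm_greatest]. *)
Definition comm (S : signature) (V : variety S) : con_operation S :=
  fun A α β => con_sup [set γ | exists C, commutator_like V C /\ γ = C A α β].

Section Commutator.
Context {S : signature} (V : variety S).

Lemma comm_greatest (C : con_operation S) (A : algebra S) (α β : con A) :
  commutator_like V C -> C A α β <= comm V α β.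
Proof. by move=> hC; apply: con_sup_ub; exists C. Qed.

Lemma comm_like : commutator_like V (comm V).
Proof.
move=> A B hA hB f α β; split.
  by apply: con_sup_lub => _ [C [hC ->]]; case: (hC _ _ hA hB f α β).
apply/eqP; rewrite eq_le leUx; apply/andP; split; first (apply/andP; split).
- apply: con_sup_lub => _ [C [hC ->]].
  have [_ e] := hC _ _ hA hB f α β.
  apply: le_trans (leUl _ (con_ker f)) _; rewrite e.
  by apply/con_leP => x y /=; apply: (con_leP _ _ (comm_greatest _ _ hC)).
- by apply/con_leP => x y /= -> θ _; exact: con_refl.
- set D := _ `|` _.
  have kD : con_ker f <= D by exact: leUr.
  have DD : D `|` con_ker f = D by apply/join_idPl.
  have h : comm V (con_push f α) (con_push f β) <= con_push f D.
    apply: con_sup_lub => _ [C [hC ->]]; apply/con_leP => u v.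
    have [x <-] := hom_surj f u; have [y <-] := hom_surj f v => h.
    exists x, y; split=> //; rewrite DD.
    have [_ e] := hC _ _ hA hB f α β.
    have : C A α β `|` con_ker f <= D by rewrite leU2 // comm_greatest.
    by rewrite e => /con_leP; apply.
  apply/con_leP => x y /= /(elimT (con_leP _ _) h)[x' [y' [ex ey]]].
  rewrite DD => Dxy; have /con_leP k := kD.
  by apply: con_trans (con_trans (k _ _ _) Dxy) (k _ _ _); rewrite /= ?ex ?ey.
Qed.

End Commutator.

Section CommutatorNotions.
Context {S : signature} (V : variety S) {A : algebra S}.
Implicit Types α β θ φ : con A.

Definition res α β : con A := con_sup [set γ | comm V α γ <= β].

Definition perp α : con A := res α \bot.

(* Index 0 is only meaningful for [α = β]. *)
Fixpoint comm_iter α β (n : nat) : con A :=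
  match n with
  | 0 => α
  | 1 => comm V α β
  | n'.+1 => comm V (comm_iter α β n') (comm_iter α β n')
  end.

Definition prime_con φ : Prop :=
  φ <> \top /\
  forall α β, comm V α β <= φ -> α <= φ \/ β <= φ.

Definition rho θ : con A := con_inf [set φ | prime_con φ /\ θ <= φ].

End CommutatorNotions.

Definition semiprime (S : signature) (V : variety S) (A : algebra S) : Prop :=
  rho V (\bot : con A) = \bot.

Definition compacts_comm_closed (S : signature) (V : variety S)
    (A : algebra S) : Prop :=
  forall α β : con A, compact α -> compact β -> compact (comm V α β).

Definition condition_star (S : signature) (V : variety S)
    (A : algebra S) : Prop :=
  forall α β : con A, compact α -> compact β -> forall n : nat, (1 <= n)%N ->
  exists m : nat,
    comm V (comm_iter V α α m) (comm_iter V β β m) <= comm_iter V α β n.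

Section Quotient.
Context {S : signature} {A : algebra S} (θ : con A).

Definition quo_carrier := {c : A -> Prop | exists a, c = θ a}.
Definition quo_class (a : A) : quo_carrier :=
  exist _ (con_rel θ a) (ex_intro _ a erefl).
Definition quo_repr (c : quo_carrier) : A := projT1 (cid (proj2_sig c)).

Definition quo_alg : algebra S := @Algebra S quo_carrier
  (let: inhabits a := carrier_inh A in inhabits (quo_class a))
  (fun o x => quo_class (op A o (fun i => quo_repr (x i)))).

Lemma quo_classP a b : quo_class a = quo_class b <-> θ a b.
Proof.
split=> [/(congr1 (@proj1_sig _ _)) /= e|h].
  by rewrite e; exact: con_refl.
apply: eq_exist; apply/funext => c; apply/propext.
by split=> k; [apply: con_trans k; exact: con_sym|exact: con_trans h k].
Qed.

Lemma quo_reprK c : quo_class (quo_repr c) = c.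
Proof.
rewrite /quo_repr; case: cid => a; case: c => c hc /= e.
exact: eq_exist.
Qed.

Lemma quo_class_op o (x : 'I_(arity o) -> A) :
  quo_class (op A o x) = op quo_alg o (fun i => quo_class (x i)).
Proof.
by apply/quo_classP; apply: con_op => i; apply/quo_classP; rewrite quo_reprK.
Qed.

Lemma quo_eval (v : nat -> A) t :
  quo_class (eval v t) = @eval S quo_alg (fun n => quo_class (v n)) t.
Proof.
elim: t => [n|o ts IH] //=; rewrite quo_class_op.
by congr (op quo_alg o); apply/funext.
Qed.

Lemma quo_in_variety (V : variety S) : in_variety V A -> in_variety V quo_alg.
Proof.
move=> hA e Ve v.
have -> : v = fun n => quo_class (quo_repr (v n)).
  by apply/funext => n; rewrite quo_reprK.
by rewrite -!quo_eval (hA _ Ve).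
Qed.

End Quotient.

Section Power.
Context {S : signature} (A : algebra S) (J : Type).

Definition pow_alg : algebra S := @Algebra S (J -> A)
  (let: inhabits a := carrier_inh A in inhabits (fun=> a))
  (fun o x j => op A o (fun i => x i j)).

Lemma pow_eval (v : nat -> pow_alg) t j :
  eval v t j = eval (fun n => v n j) t.
Proof. by elim: t => [n|o ts IH] //=; congr op; apply/funext. Qed.

Lemma pow_in_variety (V : variety S) : in_variety V A -> in_variety V pow_alg.
Proof. by move=> hA e Ve v; apply/funext => j; rewrite !pow_eval; exact: hA. Qed.

End Power.

Section CompactTop.
Context {S : signature} {V : variety S} {A : algebra S}.
Hypothesis Vsd : semidegenerate V.
Hypothesis AV : in_variety V A.

Lemma sub_bigjoin (s t : seq (con A)) :
  {subset s <= t} -> \join_(θ <- s) θ <= \join_(θ <- t) θ.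
Proof.
elim: s => [|α s IH] st; first by rewrite big_nil le0x.
rewrite big_cons leUx IH ?andbT; last by move=> x xs; apply: st; rewrite inE xs orbT.
have : α \in t by apply: st; rewrite mem_head.
elim: t {IH st} => // β t IH; rewrite inE big_cons => /orP[/eqP<-|/IH h].
  exact: leUl.
exact: le_trans h (leUr _ _).
Qed.

Section Family.
Variable F : set (con A).
Let J := {s : seq (con A) | forall θ, θ \in s -> F θ}.
Let cg (j : J) : con A := \join_(θ <- proj1_sig j) θ.
Let sub (i j : J) := {subset proj1_sig i <= proj1_sig j}.

Let ub (i j : J) : exists k, sub i k /\ sub j k.
Proof.
case: i j => [s sF] [t tF].
have h θ : θ \in s ++ t -> F θ by rewrite mem_cat => /orP[/sF|/tF].
by exists (exist _ _ h); split=> θ /= h'; rewrite mem_cat h' ?orbT.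
Qed.

Let ubn n (k : 'I_n -> J) : exists m, forall i, sub (k i) m.
Proof.
have e : forall θ, θ \in [::] -> F θ by [].
elim: n k => [|n IH] k; first by exists (exist _ [::] e) => -[].
have [m hm] := IH (fun i => k (lift ord0 i)).
have [m' [h1 h2]] := ub m (k ord0); exists m' => i.
by case: (unliftP ord0 i) => [j|] -> x; [move=> /hm /h1|exact: h2].
Qed.

Program Let dirun : con A := @Con S A (fun x y => exists j, cg j x y) _ _ _ _.
Next Obligation.
have e : forall θ, θ \in [::] -> F θ by [].
by move=> x; exists (exist _ [::] e); exact: con_refl.
Qed.
Next Obligation. by move=> x y [j h]; exists j; exact: con_sym. Qed.
Next Obligation.
move=> y x z [i hi] [j hj]; have [k [ik jk]] := ub i j; exists k.
have /con_leP h1 := sub_bigjoin ik; have /con_leP h2 := sub_bigjoin jk.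
exact: con_trans (h1 _ _ hi) (h2 _ _ hj).
Qed.
Next Obligation.
move=> o x y h; have [j hj] := choice h; have [k hk] := ubn j; exists k.
by apply: con_op => i; have /con_leP := sub_bigjoin (hk i); apply; exact: hj.
Qed.

Lemma con_sup_fin x y : con_sup F x y -> exists j : J, cg j x y.
Proof.
have : con_sup F <= dirun.
  apply: con_sup_lub => θ Fθ; apply/con_leP => u v h.
  have e : forall σ, σ \in [:: θ] -> F σ by move=> σ; rewrite inE => /eqP->.
  by exists (exist _ [:: θ] e); rewrite /cg /= big_seq1.
by move=> /con_leP; apply.
Qed.

(* The reduced power of [A] modulo the increasing family [cg] has a one-element
   subalgebra as soon as [con_sup F] is the greatest congruence. *)
Program Let red : con (pow_alg A J) := @Con S (pow_alg A J)
  (fun x y => exists i, forall j, sub i j -> cg j (x j) (y j)) _ _ _ _.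
Next Obligation.
have e : forall θ, θ \in [::] -> F θ by [].
by move=> x; exists (exist _ [::] e) => j _; exact: con_refl.
Qed.
Next Obligation.
by move=> x y [i h]; exists i => j ij; exact: con_sym (h j ij).
Qed.
Next Obligation.
move=> y x z [i hi] [i' hi']; have [k [ik jk]] := ub i i'; exists k => j kj.
apply: (@con_trans _ _ _ (y j)).
  by apply: hi => θ /ik /kj.
by apply: hi' => θ /jk /kj.
Qed.
Next Obligation.
move=> o x y h; have [i hi] := choice h; have [k hk] := ubn i; exists k => j kj.
by apply: con_op => l; apply: hi => θ /hk /kj.
Qed.

Lemma compact_top_aux : \top <= con_sup F ->
  exists s : seq (con A),
    (forall θ, θ \in s -> F θ) /\ \top <= \join_(θ <- s) θ.
Proof.
move=> /con_leP hF; apply: contrapT => nex.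
have nJ (j : J) : exists xy : A * A, ~ cg j xy.1 xy.2.
  apply: contrapT => h; apply: nex; exists (proj1_sig j); split.
    exact: (proj2_sig j).
  apply/con_leP => x y _; apply: contrapT => h'; apply: h.
  by exists (x, y).
have [xy hxy] := choice nJ.
have QV : in_variety V (quo_alg red).
  exact: quo_in_variety (pow_in_variety AV).
have [a] := carrier_inh A.
pose d : quo_alg red := quo_class red (fun=> a).
have dsub : subuniverse [set d].
  move=> o x hx; rewrite /set1 /mkset.
  have -> : x = (fun i => d) by apply/funext.
  have -> : op (quo_alg red) o (fun=> d) =
      quo_class red (op (pow_alg A J) o (fun=> fun=> a)).
    by rewrite quo_class_op.
  apply/quo_classP => /=.
  have [i hi] := con_sup_fin (hF (op A o (fun=> a)) a I).
  by exists i => j ij; have /con_leP := sub_bigjoin ij; apply.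
have := Vsd QV (ex_intro _ d dsub)
  (quo_class red (fun j => (xy j).1)) (quo_class red (fun j => (xy j).2)).
by move=> /quo_classP[i /(_ i (fun _ h => h))]; exact: hxy.
Qed.

End Family.

Lemma compact_top : compact (\top : con A).
Proof. by move=> F; exact: compact_top_aux. Qed.

End CompactTop.

Section CommPrime.
Context {S : signature} {V : variety S} {A : algebra S}.
Hypothesis AV : in_variety V A.
Implicit Types α β φ : con A.

Lemma comm_le α β : comm V α β <= α `&` β.
Proof.
have idP (y : A) : exists x, x = y by exists y.
pose f : surj_hom A A := @SurjHom S A A idfun (fun _ _ => erefl) idP.
by have [] := @comm_like S V A A AV AV f α β.
Qed.

Lemma prime_commE φ α β : prime_con V φ ->
  (comm V α β <= φ) = (α <= φ) || (β <= φ).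
Proof.
move=> [_ pφ]; apply/idP/orP; first exact: pφ.
by move=> h; apply: le_trans (comm_le α β) _; case: h => h;
  apply: le_trans h; [exact: leIl|exact: leIr].
Qed.

Lemma rho_eqP α β : rho V α = rho V β <->
  forall φ, prime_con V φ -> (α <= φ) = (β <= φ).
Proof.
have le_rho (γ : con A) : γ <= rho V γ by apply: con_inf_glb => φ [].
split=> [e φ pφ|h].
  apply/idP/idP => k.
    by apply: (le_trans (le_rho β)); rewrite -e; exact: con_inf_lb.
    by apply: (le_trans (le_rho α)); rewrite e; exact: con_inf_lb.
by apply: le_anti; apply/andP; split; apply: con_inf_glb => φ [pφ k];
  apply: con_inf_lb; split=> //; [rewrite h|rewrite -h].
Qed.

End CommPrime.

Definition K (S : signature) (A : algebra S) : choiceType :=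
  {α : con A | `[< compact α >]}.
Arguments K {S} A.

Lemma K_compact (S : signature) (A : algebra S) (α : K A) : compact (val α).
Proof. exact/asboolP/(valP α). Qed.
Arguments K_compact {S A} α.

Definition mkK (S : signature) (A : algebra S) (α : con A) (h : compact α) : K A :=
  exist _ α (asboolT h).

Section Reticulation.
Context {S : signature} {V : variety S} {A : algebra S}.

Definition rho_equiv (α β : K A) : bool := rho V (val α) == rho V (val β).

Fact rho_equiv_refl : reflexive rho_equiv.
Proof. by move=> α; exact: eqxx. Qed.
Fact rho_equiv_sym : symmetric rho_equiv.
Proof. by move=> α β; exact: eq_sym. Qed.
Fact rho_equiv_trans : transitive rho_equiv.
Proof. by move=> β α γ /eqP h /eqP k; apply/eqP; rewrite h. Qed.
Canonical rho_equiv_rel :=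
  EquivRel rho_equiv rho_equiv_refl rho_equiv_sym rho_equiv_trans.

(* The hypotheses are only used for the lattice structure of the quotient. *)
Definition reticulation
    of semidegenerate V & in_variety V A & compacts_comm_closed V A : Type :=
  {eq_quot rho_equiv}.

Context (Vsd : semidegenerate V) (AV : in_variety V A)
        (KA : compacts_comm_closed V A).
Local Notation L := (reticulation Vsd AV KA).

HB.instance Definition _ := Choice.copy L {eq_quot rho_equiv}.

Definition lam (α : K A) : L := \pi_({eq_quot rho_equiv}) α.

Lemma lamP (α β : K A) : lam α = lam β <-> rho V (val α) = rho V (val β).
Proof. by split=> [/eqmodP/eqP //|h]; apply/eqmodP/eqP. Qed.

Let rp (x : L) : K A := repr (x : {eq_quot rho_equiv}).

Let rpK x : lam (rp x) = x. Proof. exact: reprK. Qed.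

Lemma lam_surj (x : L) : exists α, lam α = x.
Proof. by exists (rp x); exact: rpK. Qed.

Definition K_join (α β : K A) : K A := mkK (compactU (K_compact α) (K_compact β)).
Definition K_comm (α β : K A) : K A := mkK (KA (K_compact α) (K_compact β)).
Definition K_delta : K A := mkK compact0.
Definition K_nabla : K A := mkK (compact_top Vsd AV).

Definition ret_join (x y : L) : L := lam (K_join (rp x) (rp y)).
Definition ret_meet (x y : L) : L := lam (K_comm (rp x) (rp y)).
Definition ret_le (x y : L) : bool := ret_meet x y == x.
Definition ret_lt (x y : L) : bool := (y != x) && ret_le x y.

Let below (x : L) (φ : con A) := val (rp x) <= φ.

Let below_lam α φ : prime_con V φ -> below (lam α) φ = (val α <= φ).
Proof. by apply: (rho_eqP _ _).1; apply/lamP; rewrite rpK. Qed.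

Let below_ext x y : (forall φ, prime_con V φ -> below x φ = below y φ) -> x = y.
Proof. by move=> h; rewrite -(rpK x) -(rpK y); apply/lamP/rho_eqP. Qed.

Let below_join x y φ : prime_con V φ ->
  below (ret_join x y) φ = below x φ && below y φ.
Proof. by move=> pφ; rewrite below_lam //= leUx. Qed.

Let below_meet x y φ : prime_con V φ ->
  below (ret_meet x y) φ = below x φ || below y φ.
Proof. by move=> pφ; rewrite below_lam //= prime_commE. Qed.

Let belowE := (below_join, below_meet).

Fact ret_meetC : commutative ret_meet.
Proof. by move=> x y; apply: below_ext => φ p; rewrite !belowE // orbC. Qed.
Fact ret_joinC : commutative ret_join.
Proof. by move=> x y; apply: below_ext => φ p; rewrite !belowE // andbC. Qed.
Fact ret_meetA : associative ret_meet.
Proof. by move=> x y z; apply: below_ext => φ p; rewrite !belowE // orbA. Qed.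
Fact ret_joinA : associative ret_join.
Proof. by move=> x y z; apply: below_ext => φ p; rewrite !belowE // andbA. Qed.
Fact ret_joinKI y x : ret_meet x (ret_join x y) = x.
Proof. by apply: below_ext => φ p; rewrite !belowE //; do 2 case: below. Qed.
Fact ret_meetKU y x : ret_join x (ret_meet x y) = x.
Proof. by apply: below_ext => φ p; rewrite !belowE //; do 2 case: below. Qed.
Fact ret_meetUl : left_distributive ret_meet ret_join.
Proof.
by move=> x y z; apply: below_ext => φ p; rewrite !belowE //; do 3 case: below.
Qed.
Fact ret_meetxx : idempotent_op ret_meet.
Proof. by move=> x; apply: below_ext => φ p; rewrite !belowE // orbb. Qed.

Fact reticulation_display : Order.disp_t. Proof. exact: Order.Disp tt tt. Qed.

HB.instance Definition _ := @Order.isMeetJoinDistrLattice.Build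
  reticulation_display L ret_le ret_lt ret_meet ret_join
  (fun _ _ => erefl) (fun _ _ => erefl) ret_meetC ret_joinC ret_meetA ret_joinA
  ret_joinKI ret_meetKU ret_meetUl ret_meetxx.

Fact ret_le0x x : lam K_delta <= x.
Proof.
apply/eqP; apply: below_ext => φ p.
by rewrite !belowE // !below_lam //= le0x.
Qed.
Fact ret_lex1 x : x <= lam K_nabla.
Proof.
apply/eqP; apply: below_ext => φ p; rewrite !belowE // !below_lam //= le1x.
case: (p) => /eqP/negPf -> _; exact: orbF.
Qed.
HB.instance Definition _ := Order.hasBottom.Build reticulation_display L ret_le0x.
HB.instance Definition _ := Order.hasTop.Build reticulation_display L ret_lex1.

Lemma lamU α β : lam (K_join α β) = lam α `|` lam β.
Proof. by apply: below_ext => φ p; rewrite !belowE // !below_lam //= leUx. Qed.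

Lemma lam_comm α β : lam (K_comm α β) = lam α `&` lam β.
Proof.
by apply: below_ext => φ p; rewrite !belowE // !below_lam //= prime_commE.
Qed.

Lemma lam0 : lam K_delta = \bot. Proof. by []. Qed.
Lemma lam1 : lam K_nabla = \top. Proof. by []. Qed.

(* The congruence written [I_*]. *)
Definition ideal_con (I : set L) : con A :=
  con_sup [set θ | exists α : K A, I (lam α) /\ θ = val α].

End Reticulation.

Section Ideals.
Context {d : Order.disp_t} {L : tbDistrLatticeType d}.

Definition is_ideal (I : set L) : Prop :=
  [/\ I \bot, forall x y, y <= x -> I x -> I y
    & forall x y, I x -> I y -> I (x `|` y)].

Definition Ann (I : set L) : set L := [set x | forall y, I y -> x `&` y = \bot].

End Ideals.

(* Main.v *)
Require Import Defs.
From mathcomp Require Import all_boot all_order.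
From mathcomp Require Import boolp classical_sets.

(** Both sides of the first equation are determined by the prime congruences.
    For compact [α] and [β], the meet of their classes in the reticulation is
    [0] exactly when every prime [φ] contains [α] or [β]
    ([lam_meet_eq0]).  Likewise, because a prime contains a commutator exactly
    when it contains one of the two factors, [[γ, δ] ⊆ ρ(Δ)] says that every
    prime contains [γ] or [δ] ([comm_le_rho0]).

    Moreover a prime contains [I_*] as soon as it contains every compact [β]
    whose class is in [I].  So for compact [α], the conditions that the class of
    [α] be in [Ann(I)] and that [[I_*, α] ⊆ ρ(Δ)] coincide ([lam_Ann]).  The
    congruence [(Ann(I))_*] is the join of the compact congruences with this
    property, and the residual is the join of all the congruences [γ] with
    [[I_*, γ] ⊆ ρ(Δ)].  This inclusion passes to smaller [γ] ([comm_rho0_le])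
    and every congruence is the join of the principal, hence compact,
    congruences below it ([compact_con_principal]), so the two joins
    agree.  In the semiprime case [ρ(Δ) = Δ], so the residual is the annihilator of [I_*]. *)

Set Implicit Arguments.
Unset Strict Implicit.
Unset Printing Implicit Defensive.
Import Order.TTheory.
Local Open Scope classical_set_scope.
Local Open Scope order_scope.

Section Principal.
Context {S : signature} {A : algebra S}.
Implicit Types γ : con A.

Definition con_principal (x y : A) : con A := con_inf [set θ : con A | θ x y].

Lemma con_principal_le x y γ : γ x y -> con_principal x y <= γ.
Proof. exact: con_inf_lb. Qed.

(** A pair in a join of congruences lies already in a finite subjoin, since the
    operations are finitary. *)
Lemma compact_con_principal x y : compact (con_principal x y).
Proof.
move=> F /con_leP /(_ x y (fun _ h => h)) /con_sup_fin[[s sF] /= sxy].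
by exists s; split=> //; exact: con_principal_le.
Qed.

End Principal.

Section Primes.
Context {S : signature} {V : variety S} {A : algebra S}.
Hypothesis AV : in_variety V A.
Implicit Types α β γ δ φ : con A.

Lemma le_rho0 γ :
  (γ <= rho V \bot) <-> (forall φ, prime_con V φ -> γ <= φ).
Proof.
split=> [h φ pφ|h]; last by apply: con_inf_glb => φ [/h].
by apply: le_trans h _; apply: con_inf_lb; split=> //; exact: le0x.
Qed.

Lemma comm_le_rho0 γ δ : (comm V γ δ <= rho V \bot) <->
  (forall φ, prime_con V φ -> (γ <= φ) || (δ <= φ)).
Proof.
rewrite le_rho0.
by split=> h φ pφ; have := h φ pφ; rewrite (prime_commE AV _ _ pφ).
Qed.

(** It suffices to test on primes, where the commutator behaves like a
    disjunction, which is monotone in each side. *)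
Lemma comm_rho0_le α γ δ : α <= δ ->
  comm V γ δ <= rho V \bot -> comm V γ α <= rho V \bot.
Proof.
move=> αδ /comm_le_rho0 h; apply/comm_le_rho0 => φ /h /orP[->//|δφ].
by rewrite (le_trans αδ δφ) orbT.
Qed.

End Primes.

Section Annihilator.
Context {S : signature} {V : variety S} {A : algebra S}.
Context (Vsd : semidegenerate V) (AV : in_variety V A)
        (KA : compacts_comm_closed V A).
Local Notation L := (reticulation Vsd AV KA).
Local Notation lam := (lam Vsd AV KA).
Implicit Types (α β : K A) (I : set L).

Lemma lam_meet_eq0 α β : lam α `&` lam β = \bot <->
  (forall φ, prime_con V φ -> (val α <= φ) || (val β <= φ)).
Proof.
rewrite -lam_comm -lam0 lamP rho_eqP.
by split=> h φ pφ; have := h φ pφ; rewrite /= (prime_commE AV _ _ pφ) le0x.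
Qed.

Lemma ideal_con_le I (θ : con A) :
  (ideal_con I <= θ) <-> (forall β, I (lam β) -> val β <= θ).
Proof.
split=> [h β Iβ|h]; last by apply: con_sup_lub => _ [β [Iβ ->]]; exact: h.
by apply: le_trans h; apply: con_sup_ub; exists β.
Qed.

(** A prime that does not contain [α] contains every compact member of [I] one
    by one, hence also their join. *)
Lemma lam_Ann I α :
  Ann I (lam α) <-> comm V (ideal_con I) (val α) <= rho V \bot.
Proof.
rewrite comm_le_rho0 //; split=> [h φ pφ|h y Iy].
  apply/orP; have [αφ|/negPf nαφ] := boolP (val α <= φ); [by right|left].
  apply/ideal_con_le => β Iβ.
  by have /lam_meet_eq0 /(_ φ pφ) := h _ Iβ; rewrite nαφ.
have [β yE] := lam_surj y; rewrite -yE in Iy *.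
apply/lam_meet_eq0 => φ pφ; have /orP[Iφ|->//] := h φ pφ.
by move/ideal_con_le: Iφ => /(_ β Iy) ->; rewrite orbT.
Qed.

Lemma ideal_con_Ann I : ideal_con (Ann I) = res V (ideal_con I) (rho V \bot).
Proof.
apply/le_anti/andP; split.
  by apply/ideal_con_le => α /lam_Ann h; exact: con_sup_ub.
apply: con_sup_lub => γ hγ; apply/con_leP => x y γxy.
pose α := mkK (@compact_con_principal S A x y).
have αγ : val α <= γ by exact: con_principal_le.
have /con_leP : val α <= ideal_con (Ann I).
  by apply: con_sup_ub; exists α; split=> //; apply/lam_Ann/(comm_rho0_le AV αγ).
by apply=> θ.
Qed.

End Annihilator.

Theorem proposition3p10 (S : signature) (V : variety S)
    (Vmod : congruence_modular V) (Vsd : semidegenerate V)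
    (A : algebra S) (AV : in_variety V A)
    (KA : compacts_comm_closed V A) (Astar : condition_star V A)
    (I : set (reticulation Vsd AV KA)) (idI : is_ideal I) :
  ideal_con (Ann I) = res V (ideal_con I) (rho V \bot%O) /\
  (semiprime V A -> ideal_con (Ann I) = perp V (ideal_con I)).
Proof.
split=> [|sA]; first exact: ideal_con_Ann.
by rewrite ideal_con_Ann sA.
Qed.
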